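(* For every real $x \in [0,1]$ the following chain of inequalities holds: $$\frac{3x}{2+\sqrt{1-x^2}} \;\leq\; \frac{6\left(\sqrt{1+x}-\sqrt{1-x}\right)}{4+\sqrt{1+x}+\sqrt{1-x}} \;\leq\; \arcsin x$$ $$\leq\; \frac{\dfrac{\pi(2-\sqrt{2})}{\pi-2\sqrt{2}}\left(\sqrt{1+x}-\sqrt{1-x}\right)}{\dfrac{\sqrt{2}(4-\pi)}{\pi-2\sqrt{2}}+\sqrt{1+x}+\sqrt{1-x}}$$ $$\leq\; \frac{\pi\left(\sqrt{2}+\frac{1}{2}\right)\left(\sqrt{1+x}-\sqrt{1-x}\right)}{4+\sqrt{1+x}+\sqrt{1-x}} \;\leq\; \frac{\pi x}{2+\sqrt{1-x^2}}.$$
   Context: Here $\arcsin$ is the principal real arcsine function with values in $[-\pi/2,\pi/2]$, and $\sqrt{\cdot}$ is the nonnegative real square root. *)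

(* Defs.v *)
From Stdlib Require Import Reals.

(* Main.v *)
Require Import Defs.
From Stdlib Require Import Reals.
From Stdlib Require Import Lra.
From Coquelicot Require Import Coquelicot.
Open Scope R_scope.

(** Put [x = sin (2 t)] with [0 <= t <= PI/4].  Then [sqrt (1 + x)] and
    [sqrt (1 - x)] are [cos t + sin t] and [cos t - sin t], so their difference
    is [2 sin t], their sum [2 cos t], and [sqrt (1 - x ^ 2) = 2 (cos t)^2 - 1].
    With [s = sin t], [c = cos t], the chain becomes, term by term,
    [6 s c / (1 + 2 c^2) <= 6 s / (2 + c) <= 2 t <= 2 A s / (B + 2 c)
     <= PI (sqrt 2 + 1/2) s / (2 + c) <= 2 PI s c / (1 + 2 c^2)].

    The two outer inequalities are polynomial in [c], which lies in
    [[sqrt 2 / 2, 1]]: after clearing denominators, the first is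
    [(c - 1)^2 >= 0], and the last holds because a convex quadratic vanishes at
    [sqrt 2 / 2] and is negative at [1].

    The lower bound on [2 t] is the Cusa-Huygens inequality
    [3 sin t <= t (2 + cos t)] ([cusa_huygens]).  The upper bound says that
    [g t = A sin t - t (B + 2 cos t)] is nonnegative.  The constants satisfy
    [A = B + 2] and make [g] vanish at [PI/4], so that [g] is zero at both
    ends of the interval; its derivative can change sign only from positive to
    negative because [u cos u / sin u] decreases, hence [g >= 0] in between
    ([cusa_reverse]).

    The fourth inequality compares affine functions of [c] that agree at
    [c = sqrt 2 / 2]; at [c = 1] it reads [6 <= PI (sqrt 2 + 1/2)], which is
    exactly the Cusa-Huygens inequality at [t = PI/4] ([PI_lower_cusa]). *)

(** * Trigonometric inequalities *)

Lemma nonneg_of_derive_nonneg (f f' : R -> R) (t : R) :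
  0 <= t -> f 0 = 0 ->
  (forall u, is_derive f u (f' u)) ->
  (forall u, 0 < u < t -> 0 <= f' u) -> 0 <= f t.
Proof.
  intros Ht H0 Hd Hpos.
  destruct Ht as [Ht | <-]; [ | lra].
  destruct (MVT_cor2 f f' 0 t Ht) as [c [Hc Hct]].
  { intros c _. now apply is_derive_Reals. }
  assert (H := Hpos c Hct). nra.
Qed.

Lemma cos_half_angle (t : R) : cos t = 1 - 2 * sin (t / 2) ^ 2.
Proof.
  replace t with (2 * (t / 2)) at 1 by field.
  rewrite cos_2a_sin. ring.
Qed.

Lemma sin_half_angle (t : R) : sin t = 2 * sin (t / 2) * cos (t / 2).
Proof.
  replace t with (2 * (t / 2)) at 1 by field.
  apply sin_2a.
Qed.

Lemma mul_cos_le_sin (t : R) : 0 <= t <= PI -> t * cos t <= sin t.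
Proof.
  intros Ht.
  enough (0 <= sin t - t * cos t) by lra.
  apply (nonneg_of_derive_nonneg
           (fun u => sin u - u * cos u) (fun u => u * sin u)).
  - lra.
  - rewrite sin_0. ring.
  - intros u. auto_derive; [exact I | ring].
  - intros u Hu. assert (0 <= sin u) by (apply sin_ge_0; lra). nra.
Qed.

(** In terms of [h = t / 2], the derivative of [t (2 + cos t) - 3 sin t] is
    [4 sin h (sin h - h cos h)], which is nonnegative. *)
Lemma cusa_huygens (t : R) : 0 <= t <= PI -> 3 * sin t <= t * (2 + cos t).
Proof.
  intros Ht.
  enough (0 <= t * (2 + cos t) - 3 * sin t) by lra.
  apply (nonneg_of_derive_nonneg
           (fun u => u * (2 + cos u) - 3 * sin u)
           (fun u => 2 - 2 * cos u - u * sin u)).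
  - lra.
  - rewrite sin_0. ring.
  - intros u. auto_derive; [exact I | ring].
  - intros u Hu.
    rewrite (cos_half_angle u), (sin_half_angle u).
    assert (0 <= sin (u / 2)) by (apply sin_ge_0; lra).
    assert (u / 2 * cos (u / 2) <= sin (u / 2)) by (apply mul_cos_le_sin; lra).
    replace (2 - 2 * (1 - 2 * sin (u / 2) ^ 2)
             - u * (2 * sin (u / 2) * cos (u / 2)))
      with (4 * (sin (u / 2) * (sin (u / 2) - u / 2 * cos (u / 2)))) by field.
    nra.
Qed.

(** The derivative of [u cos u / sin u] is
    [(sin u cos u - u) / (sin u)^2], and [sin u cos u <= sin u <= u]. *)
Lemma mul_cot_decreasing (a b : R) :
  0 < a < b -> b < PI -> b * cos b / sin b <= a * cos a / sin a.
Proof.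
  intros Hab Hb.
  destruct (MVT_cor2 (fun u => u * cos u / sin u)
              (fun u => (sin u * cos u - u) / sin u ^ 2) a b)
    as [c [Hc Hcab]].
  - lra.
  - intros u Hu. apply is_derive_Reals.
    assert (0 < sin u) by (apply sin_gt_0; lra).
    auto_derive; [lra | ].
    assert (Hsc := sin2_cos2 u). unfold Rsqr in Hsc.
    field_simplify; [ | lra | lra].
    f_equal.
    replace (sin u ^ 2) with (1 - cos u ^ 2) by nra. ring.
  - cbv beta in Hc.
    enough ((sin c * cos c - c) / sin c ^ 2 <= 0) by nra.
    assert (0 < sin c) by (apply sin_gt_0; lra).
    assert (sin c < c) by (apply sin_lt_x; lra).
    assert (Hcos := COS_bound c).
    assert (0 < / sin c ^ 2) by (apply Rinv_0_lt_compat; nra).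
    assert (sin c * cos c - c <= 0) by nra.
    unfold Rdiv. nra.
Qed.

(** With [h = t / 2], the derivative of [g t = (B + 2) sin t - t (B + 2 cos t)]
    is [2 sin h (4 h cos h - B sin h)], whose sign is that of
    [4 h cos h / sin h - B].  If [g] were negative at [t], then the mean value
    theorem on [[0, t]] and on [[t, T]] would make this sign negative at a point
    and positive at a later one, against [mul_cot_decreasing]. *)
Lemma cusa_reverse (B T t : R) :
  T <= PI -> T * (B + 2 * cos T) <= (B + 2) * sin T ->
  0 <= t <= T -> t * (B + 2 * cos t) <= (B + 2) * sin t.
Proof.
  intros HT HgT Ht.
  set (g := fun u => (B + 2) * sin u - u * (B + 2 * cos u)).
  set (g' := fun u =>
    2 * sin (u / 2) * (4 * (u / 2) * cos (u / 2) - B * sin (u / 2))).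
  assert (Hd : forall u, derivable_pt_lim g u (g' u)).
  { intros u. apply is_derive_Reals. unfold g, g'.
    auto_derive; [exact I | ].
    rewrite (cos_half_angle u), (sin_half_angle u). field. }
  apply Rnot_lt_le. intros Hneg.
  assert (g0 : g 0 = 0) by (unfold g; rewrite sin_0; ring).
  assert (gT : 0 <= g T) by (unfold g; lra).
  assert (gt : g t < 0) by (unfold g; lra).
  assert (0 < t).
  { destruct Ht as [[Ht | <-] _]; lra. }
  assert (t < T).
  { destruct Ht as [_ [Ht | ->]]; lra. }
  destruct (MVT_cor2 g g' 0 t) as [a [Ha Ha0]]; [lra | auto | ].
  destruct (MVT_cor2 g g' t T) as [b [Hb Hb0]]; [lra | auto | ].
  assert (Ha' : g' a < 0) by nra.
  assert (Hb' : 0 < g' b) by nra.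
  assert (sa : 0 < sin (a / 2)) by (apply sin_gt_0; lra).
  assert (sb : 0 < sin (b / 2)) by (apply sin_gt_0; lra).
  assert (Hmono : b / 2 * cos (b / 2) / sin (b / 2)
                  <= a / 2 * cos (a / 2) / sin (a / 2))
    by (apply mul_cot_decreasing; lra).
  assert (HaB : 4 * (a / 2 * cos (a / 2) / sin (a / 2)) < B).
  { apply Rmult_lt_reg_r with (sin (a / 2)); [exact sa | ].
    replace (4 * (a / 2 * cos (a / 2) / sin (a / 2)) * sin (a / 2))
      with (4 * (a / 2) * cos (a / 2)) by (field; lra).
    unfold g' in Ha'. nra. }
  assert (HbB : B < 4 * (b / 2 * cos (b / 2) / sin (b / 2))).
  { apply Rmult_lt_reg_r with (sin (b / 2)); [exact sb | ].
    replace (4 * (b / 2 * cos (b / 2) / sin (b / 2)) * sin (b / 2))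
      with (4 * (b / 2) * cos (b / 2)) by (field; lra).
    unfold g' in Hb'. nra. }
  lra.
Qed.

(** * Constants *)

Lemma sqrt2_sq : sqrt 2 * sqrt 2 = 2.
Proof. apply sqrt_sqrt. lra. Qed.

Lemma sqrt2_bounds : 1.4 < sqrt 2 < 1.5.
Proof.
  assert (H := sqrt2_sq). assert (0 <= sqrt 2) by apply sqrt_pos. nra.
Qed.

Lemma cos_PI4_half_sqrt2 : cos (PI / 4) = sqrt 2 / 2.
Proof.
  rewrite cos_PI4. assert (H := sqrt2_sq). assert (H' := sqrt2_bounds).
  apply Rmult_eq_reg_r with (sqrt 2); [ | lra].
  unfold Rdiv. rewrite Rmult_1_l, Rinv_l by lra. lra.
Qed.

Lemma sin_PI4_half_sqrt2 : sin (PI / 4) = sqrt 2 / 2.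
Proof. rewrite sin_cos_PI4. exact cos_PI4_half_sqrt2. Qed.

(** At [t = PI / 4] the Cusa-Huygens inequality reads
    [6 sqrt 2 <= PI (2 + sqrt 2 / 2) = PI (sqrt 2 + 1 / 2) sqrt 2]. *)
Lemma PI_lower_cusa : 6 <= PI * (sqrt 2 + 1 / 2).
Proof.
  assert (HPI := PI_RGT_0).
  assert (H := cusa_huygens (PI / 4) ltac:(lra)).
  rewrite sin_PI4_half_sqrt2, cos_PI4_half_sqrt2 in H.
  assert (H2 := sqrt2_sq). assert (H' := sqrt2_bounds).
  apply Rmult_le_reg_r with (sqrt 2); [lra | ].
  replace (PI * (sqrt 2 + 1 / 2) * sqrt 2)
    with (PI * (sqrt 2 * sqrt 2) + PI * sqrt 2 / 2) by field.
  rewrite H2. lra.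
Qed.

Lemma two_sqrt2_lt_PI : 2 * sqrt 2 < PI.
Proof. assert (H := sqrt2_bounds). assert (H' := PI2_3_2). lra. Qed.

(** * The substitution x = sin (2 t) *)

Lemma half_asin_bounds (x : R) : 0 <= x <= 1 -> 0 <= asin x / 2 <= PI / 4.
Proof.
  intros Hx. assert (H := asin_bound x).
  split; [ | lra].
  apply Rmult_le_pos; [ | lra].
  destruct (Rle_or_lt 0 (asin x)) as [h | h]; [exact h | exfalso].
  assert (sin (asin x) < sin 0) by (apply sin_increasing_1; lra).
  rewrite sin_asin, sin_0 in *; lra.
Qed.

Lemma cos_ge_half_sqrt2 (t : R) : 0 <= t <= PI / 4 -> sqrt 2 / 2 <= cos t.
Proof.
  intros Ht. rewrite <- cos_PI4_half_sqrt2. assert (H := PI_RGT_0).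
  apply cos_decr_1; lra.
Qed.

Lemma sin_le_cos (t : R) : 0 <= t <= PI / 4 -> sin t <= cos t.
Proof.
  intros Ht. assert (H := PI_RGT_0).
  apply Rle_trans with (sqrt 2 / 2).
  - rewrite <- sin_PI4_half_sqrt2. apply sin_incr_1; lra.
  - now apply cos_ge_half_sqrt2.
Qed.

Lemma sqrt_1_plus_sin_double (t : R) :
  0 <= t <= PI / 4 -> sqrt (1 + sin (2 * t)) = cos t + sin t.
Proof.
  intros Ht. assert (H := PI_RGT_0).
  assert (0 <= sin t) by (apply sin_ge_0; lra).
  assert (Hle := sin_le_cos t Ht).
  rewrite sin_2a. assert (Hsc := sin2_cos2 t). unfold Rsqr in Hsc.
  replace (1 + 2 * sin t * cos t) with ((cos t + sin t) * (cos t + sin t))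
    by nra.
  apply sqrt_square. lra.
Qed.

Lemma sqrt_1_minus_sin_double (t : R) :
  0 <= t <= PI / 4 -> sqrt (1 - sin (2 * t)) = cos t - sin t.
Proof.
  intros Ht. assert (Hle := sin_le_cos t Ht).
  rewrite sin_2a. assert (Hsc := sin2_cos2 t). unfold Rsqr in Hsc.
  replace (1 - 2 * sin t * cos t) with ((cos t - sin t) * (cos t - sin t))
    by nra.
  apply sqrt_square. lra.
Qed.

Lemma sqrt_1_minus_sin_double_sq (t : R) :
  0 <= t <= PI / 4 -> sqrt (1 - sin (2 * t) ^ 2) = 2 * cos t ^ 2 - 1.
Proof.
  intros Ht. assert (H := PI_RGT_0).
  assert (Hc : cos (2 * t) = 2 * cos t ^ 2 - 1) by (rewrite cos_2a_cos; ring).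
  rewrite <- Hc.
  assert (Hsc := sin2_cos2 (2 * t)). unfold Rsqr in Hsc.
  replace (1 - sin (2 * t) ^ 2) with (cos (2 * t) * cos (2 * t)) by nra.
  apply sqrt_square. apply cos_ge_0; lra.
Qed.

(** * The chain *)

Lemma Rdiv_le_cross (a b c d : R) :
  0 < b -> 0 < d -> a * d <= c * b -> a / b <= c / d.
Proof.
  intros Hb Hd H.
  apply Rmult_le_reg_r with (b * d); [nra | ].
  replace (a / b * (b * d)) with (a * d) by (field; lra).
  replace (c / d * (b * d)) with (c * b) by (field; lra).
  exact H.
Qed.

Theorem theorem1p10 (x : R) (hx : 0 <= x <= 1) :
  3 * x / (2 + sqrt (1 - x ^ 2))
    <= 6 * (sqrt (1 + x) - sqrt (1 - x)) / (4 + sqrt (1 + x) + sqrt (1 - x))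
  /\
  6 * (sqrt (1 + x) - sqrt (1 - x)) / (4 + sqrt (1 + x) + sqrt (1 - x))
    <= asin x
  /\
  asin x
    <= PI * (2 - sqrt 2) / (PI - 2 * sqrt 2) * (sqrt (1 + x) - sqrt (1 - x))
       / (sqrt 2 * (4 - PI) / (PI - 2 * sqrt 2) + sqrt (1 + x) + sqrt (1 - x))
  /\
  PI * (2 - sqrt 2) / (PI - 2 * sqrt 2) * (sqrt (1 + x) - sqrt (1 - x))
       / (sqrt 2 * (4 - PI) / (PI - 2 * sqrt 2) + sqrt (1 + x) + sqrt (1 - x))
    <= PI * (sqrt 2 + 1 / 2) * (sqrt (1 + x) - sqrt (1 - x))
       / (4 + sqrt (1 + x) + sqrt (1 - x))
  /\
  PI * (sqrt 2 + 1 / 2) * (sqrt (1 + x) - sqrt (1 - x))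
       / (4 + sqrt (1 + x) + sqrt (1 - x))
    <= PI * x / (2 + sqrt (1 - x ^ 2)).
Proof.
  assert (HPI := PI_RGT_0). assert (HPI4 := PI_4).
  assert (Hd := two_sqrt2_lt_PI).
  assert (H2 := sqrt2_sq). assert (H2b := sqrt2_bounds).
  set (t := asin x / 2).
  assert (Ht : 0 <= t <= PI / 4) by now apply half_asin_bounds.
  assert (Hasin : asin x = 2 * t) by (unfold t; field).
  assert (Hx : x = sin (2 * t)) by (rewrite <- Hasin, sin_asin; lra).
  rewrite Hasin. clearbody t.
  rewrite Hx.
  rewrite sqrt_1_plus_sin_double, sqrt_1_minus_sin_double,
    sqrt_1_minus_sin_double_sq, sin_2a by exact Ht.
  assert (Hcusa := cusa_huygens t ltac:(lra)).
  set (B := sqrt 2 * (4 - PI) / (PI - 2 * sqrt 2)).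
  assert (HB : 0 <= B).
  { unfold B. apply Rmult_le_pos; [nra | ].
    left. apply Rinv_0_lt_compat. lra. }
  assert (HA : PI * (2 - sqrt 2) / (PI - 2 * sqrt 2) = B + 2)
    by (unfold B; field; lra).
  rewrite HA.
  (* The function of [cusa_reverse] vanishes at [PI / 4]. *)
  assert (HBT : PI * (B + sqrt 2) = 2 * sqrt 2 * (B + 2)).
  { unfold B. field_simplify_eq; [ | lra].
    replace (sqrt 2 ^ 2) with 2 by (simpl; lra). ring. }
  assert (Hrev : t * (B + 2 * cos t) <= (B + 2) * sin t).
  { apply cusa_reverse with (PI / 4); [lra | | exact Ht].
    rewrite sin_PI4_half_sqrt2, cos_PI4_half_sqrt2. lra. }
  (* The fourth inequality is an equality at [cos t = sqrt 2 / 2]. *)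
  assert (HBP : (B + 2) * (4 + sqrt 2) = PI * (sqrt 2 + 1 / 2) * (B + sqrt 2)).
  { replace (PI * (sqrt 2 + 1 / 2) * (B + sqrt 2))
      with ((sqrt 2 + 1 / 2) * (PI * (B + sqrt 2))) by ring.
    rewrite HBT.
    replace ((sqrt 2 + 1 / 2) * (2 * sqrt 2 * (B + 2)))
      with ((B + 2) * (2 * (sqrt 2 * sqrt 2) + sqrt 2)) by field.
    rewrite H2. ring. }
  assert (HK := PI_lower_cusa).
  clearbody B.
  assert (Hs : 0 <= sin t) by (apply sin_ge_0; lra).
  assert (Hc := cos_ge_half_sqrt2 t Ht).
  assert (Hc1 := proj2 (COS_bound t)).
  set (s := sin t) in *. set (c := cos t) in *.
  clearbody s c.
  replace (c + s - (c - s)) with (2 * s) by ring.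
  replace (4 + (c + s) + (c - s)) with (2 * (2 + c)) by ring.
  replace (B + (c + s) + (c - s)) with (B + 2 * c) by ring.
  replace (2 + (2 * c ^ 2 - 1)) with (1 + 2 * c ^ 2) by ring.
  assert (0 < 1 + 2 * c ^ 2) by nra.
  repeat split.
  - apply Rdiv_le_cross; [lra | lra | ].
    enough (0 <= s * (c - 1) ^ 2) by nra.
    apply Rmult_le_pos; [lra | apply pow2_ge_0].
  - replace (2 * t) with (2 * t / 1) by field.
    apply Rdiv_le_cross; lra.
  - replace (2 * t) with (2 * t / 1) by field.
    apply Rdiv_le_cross; lra.
  - apply Rdiv_le_cross; [lra | lra | ].
    set (K := PI * (sqrt 2 + 1 / 2)) in *.
    enough (0 <= K * (B + 2 * c) - (B + 2) * (4 + 2 * c)) by nra.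
    (* An affine function of [c] with a zero at [sqrt 2 / 2] is fixed by its
       value at [1]. *)
    apply Rmult_le_reg_r with (1 - sqrt 2 / 2); [lra | ].
    replace ((K * (B + 2 * c) - (B + 2) * (4 + 2 * c)) * (1 - sqrt 2 / 2))
      with ((B + 2) * (K - 6) * (c - sqrt 2 / 2)
            + (1 - c) * (K * (B + sqrt 2) - (B + 2) * (4 + sqrt 2))) by field.
    rewrite <- HBP.
    assert (0 <= (B + 2) * (K - 6)) by (apply Rmult_le_pos; lra).
    nra.
  - apply Rdiv_le_cross; [lra | lra | ].
    (* The quadratic in [c] left after clearing denominators, factored
       modulo [sqrt 2 * sqrt 2 = 2]. *)
    assert (Hq : (sqrt 2 + 1 / 2) * (1 + 2 * c ^ 2) - c * (4 + 2 * c)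
      = (c - sqrt 2 / 2) * ((2 * sqrt 2 - 1) * c - (2 + sqrt 2 / 2))
        + (sqrt 2 * sqrt 2 - 2) * (c - 1 / 4)) by field.
    rewrite H2 in Hq.
    assert (Hq' : (sqrt 2 + 1 / 2) * (1 + 2 * c ^ 2) <= c * (4 + 2 * c)).
    { assert ((2 * sqrt 2 - 1) * c - (2 + sqrt 2 / 2) <= 0) by nra.
      nra. }
    assert (0 <= PI * s) by nra.
    nra.
Qed.
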